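(* Let $V\xrightarrow{R}\mathfrak{g}$ be an rRB Leibniz algebra and let $(W\xrightarrow{S}\mathfrak{h},l,r)$ be a representation of it. Let $\mathrm{Ext}(V\xrightarrow{R}\mathfrak{g};W\xrightarrow{S}\mathfrak{h})$ denote the set of isomorphism classes of abelian extensions of $V\xrightarrow{R}\mathfrak{g}$ by the $2$-term chain complex $W\xrightarrow{S}\mathfrak{h}$ whose induced representation coincides with the given one. Then there is a one-to-one correspondence between $\mathrm{Ext}(V\xrightarrow{R}\mathfrak{g};W\xrightarrow{S}\mathfrak{h})$ and the second cohomology group $H^2_\mathrm{rRB}(V\xrightarrow{R}\mathfrak{g};W\xrightarrow{S}\mathfrak{h})$.
   Context: All vector spaces and linear maps are over a field $\mathbf{k}$ of characteristic $0$. Leibniz algebra: a vector space $\mathfrak{g}$ with a linear map $[~,~]_\mathfrak{g}:\mathfrak{g}\otimes\mathfrak{g}\to\mathfrak{g}$ satisfying $[x,[y,z]_\mathfrak{g}]_\mathfrak{g}=[[x,y]_\mathfrak{g},z]_\mathfrak{g}+[y,[x,z]_\mathfrak{g}]_\mathfrak{g}$. A representation of $\mathfrak{g}$ is a vector space $V$ with linear maps $l_V:\mathfrak{g}\otimes V\to V$, $r_V:V\otimes\mathfrak{g}\to V$ such that $l_V(x,l_V(y,v))=l_V([x,y]_\mathfrak{g},v)+l_V(y,l_V(x,v))$; $l_V(x,r_V(v,y))=r_V(l_V(x,v),y)+r_V(v,[x,y]_\mathfrak{g})$; $r_V(v,[x,y]_\mathfrak{g})=r_V(r_V(v,x),y)+l_V(x,r_V(v,y))$.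 An rRB Leibniz algebra $V\xrightarrow{R}\mathfrak{g}$ consists of a Leibniz algebra $\mathfrak{g}$, a representation $(V,l_V,r_V)$ of it, and a relative Rota-Baxter operator, i.e. a linear map $R:V\to\mathfrak{g}$ with $[R(v),R(v')]_\mathfrak{g}=R(l_V(R(v),v')+r_V(v,R(v')))$. A morphism from $V\xrightarrow{R}\mathfrak{g}$ to $V'\xrightarrow{R'}\mathfrak{g}'$ is a pair $(\phi,\psi)$ of a Leibniz algebra morphism $\phi:\mathfrak{g}\to\mathfrak{g}'$ and a linear map $\psi:V\to V'$ with $\psi(l_V(x,v))=l_{V'}(\phi(x),\psi(v))$, $\psi(r_V(v,x))=r_{V'}(\psi(v),\phi(x))$, $\phi\circ R=R'\circ\psi$. A representation of $V\xrightarrow{R}\mathfrak{g}$ is a triple $(W\xrightarrow{S}\mathfrak{h},l,r)$ where $W$ and $\mathfrak{h}$ are representations of the Leibniz algebra $\mathfrak{g}$ (actions $l_W,r_W$ and $l_\mathfrak{h},r_\mathfrak{h}$), $S:W\to\mathfrak{h}$ is a linear map (a 2-term chain complex), and $l:V\otimes\mathfrak{h}\to W$, $r:\mathfrak{h}\otimes V\to W$ are linear maps such that for all $x\in\mathfrak{g}$, $v\in V$, $h\in\mathfrak{h}$, $w\in W$: $l_W(x,l(v,h))=l(l_V(x,v),h)+l(v,l_\mathfrak{h}(x,h))$; $l(v,l_\mathfrak{h}(x,h))=l(r_V(v,x),h)+l_W(x,l(v,h))$; $l(v,r_\mathfrak{h}(h,x))=r_W(l(v,h),x)+r(h,r_V(v,x))$;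 $l_W(x,r(h,v))=r(l_\mathfrak{h}(x,h),v)+r(h,l_V(x,v))$; $r(h,l_V(x,v))=r(r_\mathfrak{h}(h,x),v)+l_W(x,r(h,v))$; $r(h,r_V(v,x))=r_W(r(h,v),x)+l(v,r_\mathfrak{h}(h,x))$; $l_\mathfrak{h}(R(v),S(w))=S(l_W(R(v),w)+l(v,S(w)))$; $r_\mathfrak{h}(S(w),R(v))=S(r(S(w),v)+r_W(w,R(v)))$. Abelian extensions: regard a 2-term complex $W\xrightarrow{S}\mathfrak{h}$ as an rRB Leibniz algebra with zero bracket on $\mathfrak{h}$ and zero $\mathfrak{h}$-actions on $W$. An abelian extension of $V\xrightarrow{R}\mathfrak{g}$ by $W\xrightarrow{S}\mathfrak{h}$ is an rRB Leibniz algebra $\widehat V\xrightarrow{\widehat R}\widehat{\mathfrak{g}}$ with morphisms of rRB Leibniz algebras $(i,\overline i)$ from $W\xrightarrow{S}\mathfrak{h}$ to $\widehat V\xrightarrow{\widehat R}\widehat{\mathfrak{g}}$ and $(p,\overline p)$ from $\widehat V\xrightarrow{\widehat R}\widehat{\mathfrak{g}}$ to $V\xrightarrow{R}\mathfrak{g}$ such that $0\to\mathfrak{h}\xrightarrow{i}\widehat{\mathfrak{g}}\xrightarrow{p}\mathfrak{g}\to0$ and $0\to W\xrightarrow{\overline i}\widehat V\xrightarrow{\overline p}V\to0$ are exact. Two abelian extensions are isomorphic if there is an isomorphism $(\phi,\psi)$ of rRB Leibniz algebras from $\widehat V\xrightarrow{\widehat R}\widehat{\mathfrak{g}}$ to $\widehat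 V'\xrightarrow{\widehat R'}\widehat{\mathfrak{g}}'$ with $\phi\circ i=i'$, $p'\circ\phi=p$, $\psi\circ\overline i=\overline i'$, $\overline p'\circ\psi=\overline p$. Induced representation: choose linear maps $s:\mathfrak{g}\to\widehat{\mathfrak{g}}$, $\overline s:V\to\widehat V$ with $p\circ s=\mathrm{id}_\mathfrak{g}$, $\overline p\circ\overline s=\mathrm{id}_V$; then (identifying $\mathfrak{h}$ and $W$ with their images under $i$ and $\overline i$) $l_\mathfrak{h}(x,h)=[s(x),i(h)]_{\widehat{\mathfrak{g}}}$, $r_\mathfrak{h}(h,x)=[i(h),s(x)]_{\widehat{\mathfrak{g}}}$, $l_W(x,w)=l_{\widehat V}(s(x),\overline i(w))$, $r_W(w,x)=r_{\widehat V}(\overline i(w),s(x))$, $l(v,h)=r_{\widehat V}(\overline s(v),i(h))$, $r(h,v)=l_{\widehat V}(i(h),\overline s(v))$ define a representation $(W\xrightarrow{S}\mathfrak{h},l,r)$ of $V\xrightarrow{R}\mathfrak{g}$, independent of the choice of $(s,\overline s)$. Cohomology: let $\mathfrak{g}^{n-1,1}$ be the direct sum of all $n$-fold tensor products of $n-1$ copies of $\mathfrak{g}$ and one copy of $V$ in all orders. Put $C^0_\mathrm{rRB}=0$, $C^1_\mathrm{rRB}=\mathrm{Hom}(\mathfrak{g},\mathfrak{h})\oplus\mathrm{Hom}(V,W)$ and $C^n_\mathrm{rRB}=\mathrm{Hom}(\mathfrak{g}^{\otimes n},\mathfrak{h})\oplus\mathrm{Hom}(\mathfrak{g}^{n-1,1},W)\oplus\mathrm{Hom}(V^{\otimes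 n-1},\mathfrak{h})$ for $n\ge2$. The differential is $\delta'_\mathrm{rRB}(\alpha,\beta,\gamma)=(\delta_{\mathfrak{g},\mathfrak{h}}\alpha,\ \delta^\alpha_{\mathfrak{g},W}\beta,\ \delta_{V,\mathfrak{h}}\gamma+h_R(\alpha,\beta))$ (with $\gamma=0$ when $n=1$), with components as follows. Let $x\cdot y$ denote the operation among $[~,~]_\mathfrak{g},l_V,r_V,l_\mathfrak{h},r_\mathfrak{h},l_W,r_W,l,r$ determined by the spaces containing $x$ and $y$ ($l$ for $x\in V,y\in\mathfrak{h}$; $r$ for $x\in\mathfrak{h},y\in V$). For $c=\alpha$ and $x_1,\ldots,x_{n+1}\in\mathfrak{g}$ (giving $\delta_{\mathfrak{g},\mathfrak{h}}\alpha$), and for $c=\alpha+\beta$ with exactly one of $x_1,\ldots,x_{n+1}$ in $V$ and the others in $\mathfrak{g}$ (giving $\delta^\alpha_{\mathfrak{g},W}\beta$; here $c$ means $\alpha$ when all its arguments are in $\mathfrak{g}$ and $\beta$ when exactly one is in $V$), the value at $(x_1,\ldots,x_{n+1})$ is $$\sum_{i=1}^n(-1)^{i+1}x_i\cdot c(x_1,\ldots,\widehat{x_i},\ldots,x_{n+1})+(-1)^{n+1}c(x_1,\ldots,x_n)\cdot x_{n+1}+\sum_{1\le i<j\le n+1}(-1)^ic(x_1,\ldots,\widehat{x_i},\ldots,x_{j-1},x_i\cdot x_j,x_{j+1},\ldots,x_{n+1}).$$ For $\gamma\in\mathrm{Hom}(V^{\otimes n-1},\mathfrak{h})$, with $l_\triangleright(v,h)=l_\mathfrak{h}(R(v),h)-S(l(v,h))$,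 $r_\triangleleft(h,v)=r_\mathfrak{h}(h,R(v))-S(r(h,v))$ and $[v,v']_R=l_V(R(v),v')+r_V(v,R(v'))$, $$(\delta_{V,\mathfrak{h}}\gamma)(v_1,\ldots,v_n)=\sum_{i=1}^{n-1}(-1)^{i+1}l_\triangleright(v_i,\gamma(v_1,\ldots,\widehat{v_i},\ldots,v_n))+(-1)^nr_\triangleleft(\gamma(v_1,\ldots,v_{n-1}),v_n)+\sum_{1\le i<j\le n}(-1)^i\gamma(v_1,\ldots,\widehat{v_i},\ldots,v_{j-1},[v_i,v_j]_R,v_{j+1},\ldots,v_n),$$ and $$h_R(\alpha,\beta)(v_1,\ldots,v_n)=(-1)^n\Big\{\alpha(R(v_1),\ldots,R(v_n))-\sum_{i=1}^nS\big(\beta(R(v_1),\ldots,v_i,\ldots,R(v_n))\big)\Big\}.$$ Then $(\delta'_\mathrm{rRB})^2=0$, and $H^n_\mathrm{rRB}(V\xrightarrow{R}\mathfrak{g};W\xrightarrow{S}\mathfrak{h})$ is the $n$-th cohomology group of this complex. *)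

(* Defs.v *)
From HB Require Import structures.
From mathcomp Require Import all_boot all_order all_algebra.
From mathcomp Require Import boolp classical_sets functions.

Set Implicit Arguments.
Unset Strict Implicit.
Unset Printing Implicit Defensive.

Import GRing.Theory.
Local Open Scope classical_set_scope.
Local Open Scope ring_scope.

Section ZeroBilinear.
Variables (k : fieldType) (U V W : lmodType k).

Definition zero_bilin_fun (_ : U) (_ : V) : W := 0.

Fact zero_bilin_fun_bilinear : bilinear_for *:%R *:%R zero_bilin_fun.
Proof.
by split=> u a x y /=; rewrite /zero_bilin_fun scaler0 addr0.
Qed.

HB.instance Definition _ :=
  bilinear_isBilinear.Build k U V W *:%R *:%R zero_bilin_fun
    zero_bilin_fun_bilinear.

Definition zero_bilin : {bilinear U -> V -> W} := zero_bilin_fun.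

End ZeroBilinear.

Record leibniz (k : fieldType) := Leibniz {
  leib_sort :> lmodType k;
  brk : {bilinear leib_sort -> leib_sort -> leib_sort};
  brkP : forall x y z, brk x (brk y z) = brk (brk x y) z + brk y (brk x z) }.
Arguments brk {k l}.

Record leib_rep (k : fieldType) (g : leibniz k) := LeibRep {
  rep_sort :> lmodType k;
  actl : {bilinear g -> rep_sort -> rep_sort};
  actr : {bilinear rep_sort -> g -> rep_sort};
  actllP : forall x y v,
    actl x (actl y v) = actl (brk x y) v + actl y (actl x v);
  actlrP : forall x v y,
    actl x (actr v y) = actr (actl x v) y + actr v (brk x y);
  actrrP : forall v x y,
    actr v (brk x y) = actr (actr v x) y + actl x (actr v y) }.
Arguments actl {k g l}.
Arguments actr {k g l}.

Record rRB (k : fieldType) := RRB {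
  rrb_g : leibniz k;
  rrb_V : leib_rep rrb_g;
  rrb_R : {linear rrb_V -> rrb_g};
  rrb_RP : forall v v', brk (rrb_R v) (rrb_R v') =
    rrb_R (actl (rrb_R v) v' + actr v (rrb_R v')) }.
Arguments rrb_g {k}.
Arguments rrb_V {k}.
Arguments rrb_R {k}.

Record rRB_mor (k : fieldType) (A A' : rRB k) := RRBMor {
  mor_phi : {linear rrb_g A -> rrb_g A'};
  mor_psi : {linear rrb_V A -> rrb_V A'};
  mor_br : forall x y, mor_phi (brk x y) = brk (mor_phi x) (mor_phi y);
  mor_l : forall x v, mor_psi (actl x v) = actl (mor_phi x) (mor_psi v);
  mor_r : forall v x, mor_psi (actr v x) = actr (mor_psi v) (mor_phi x);
  mor_R : forall v, mor_phi (rrb_R A v) = rrb_R A' (mor_psi v) }.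

Record rRB_rep (k : fieldType) (A : rRB k) := RRBRep {
  rr_W : leib_rep (rrb_g A);
  rr_h : leib_rep (rrb_g A);
  rr_S : {linear rr_W -> rr_h};
  rr_l : {bilinear rrb_V A -> rr_h -> rr_W};
  rr_r : {bilinear rr_h -> rrb_V A -> rr_W};
  rr_llP : forall x v h,
    actl x (rr_l v h) = rr_l (actl x v) h + rr_l v (actl x h);
  rr_lrP : forall v x h,
    rr_l v (actl x h) = rr_l (actr v x) h + actl x (rr_l v h);
  rr_lrrP : forall v h x,
    rr_l v (actr h x) = actr (rr_l v h) x + rr_r h (actr v x);
  rr_rlP : forall x h v,
    actl x (rr_r h v) = rr_r (actl x h) v + rr_r h (actl x v);
  rr_rrlP : forall h x v,
    rr_r h (actl x v) = rr_r (actr h x) v + actl x (rr_r h v);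
  rr_rrrP : forall h v x,
    rr_r h (actr v x) = actr (rr_r h v) x + rr_l v (actr h x);
  rr_lSP : forall v w, actl (rrb_R A v) (rr_S w) =
    rr_S (actl (rrb_R A v) w + rr_l v (rr_S w));
  rr_rSP : forall w v, actr (rr_S w) (rrb_R A v) =
    rr_S (rr_r (rr_S w) v + actr w (rrb_R A v)) }.

Section AbelianExtension.
Variable k : fieldType.

Section Complex.
Variables (W h : lmodType k) (S : {linear W -> h}).

Definition ab_leibniz : leibniz k.
Proof.
by apply: (@Leibniz k h (zero_bilin h h h)) => x y z; rewrite /= /zero_bilin_fun addr0.
Defined.

Definition ab_rep : leib_rep ab_leibniz.
Proof.
by apply: (@LeibRep k ab_leibniz W (zero_bilin h W W) (zero_bilin W h W)) => x y z;
  rewrite /= /zero_bilin_fun addr0.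
Defined.

Definition complex_rRB : rRB k.
Proof.
by apply: (@RRB k ab_leibniz ab_rep S) => v v';
  rewrite /= /zero_bilin_fun addr0 linear0.
Defined.

End Complex.

Definition short_exact (X Y Z : lmodType k) (i : X -> Y) (p : Y -> Z) :=
  [/\ injective i, range i = p @^-1` [set 0] & range p = setT].

Record ab_ext (A : rRB k) (W h : lmodType k) (S : {linear W -> h}) := AbExt {
  ext_tot : rRB k;
  ext_i : rRB_mor (complex_rRB S) ext_tot;
  ext_p : rRB_mor ext_tot A;
  ext_exact_g : short_exact (mor_phi ext_i) (mor_phi ext_p);
  ext_exact_V : short_exact (mor_psi ext_i) (mor_psi ext_p) }.

Definition ext_iso (A : rRB k) (W h : lmodType k) (S : {linear W -> h})
    (E E' : ab_ext A S) : Prop :=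
  exists f : rRB_mor (ext_tot E) (ext_tot E'),
    [/\ bijective (mor_phi f), bijective (mor_psi f),
        (forall x, mor_phi f (mor_phi (ext_i E) x) = mor_phi (ext_i E') x) /\
        (forall x, mor_phi (ext_p E') (mor_phi f x) = mor_phi (ext_p E) x) &
        (forall w, mor_psi f (mor_psi (ext_i E) w) = mor_psi (ext_i E') w) /\
        (forall v, mor_psi (ext_p E') (mor_psi f v) = mor_psi (ext_p E) v)].

(* The induced representation does not depend on the sections s and t, which
   always exist over a field, so one pair of sections computes it. *)
Definition ext_induces (A : rRB k) (M : rRB_rep A) (E : ab_ext A (rr_S M))
    : Prop :=
  let ih (h : rr_h M) := mor_phi (ext_i E) h in
  let iW (w : rr_W M) := mor_psi (ext_i E) w in
  exists (s : {linear rrb_g A -> rrb_g (ext_tot E)})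
         (t : {linear rrb_V A -> rrb_V (ext_tot E)}),
    [/\ cancel s (mor_phi (ext_p E)), cancel t (mor_psi (ext_p E)),
        (forall x h, ih (actl x h) = brk (s x) (ih h)) /\
        (forall h x, ih (actr h x) = brk (ih h) (s x)),
        (forall x w, iW (actl x w) = actl (s x) (iW w)) /\
        (forall w x, iW (actr w x) = actr (iW w) (s x)) &
        (forall v h, iW (rr_l M v h) = actr (t v) (ih h)) /\
        (forall h v, iW (rr_r M h v) = actl (ih h) (t v))].

(* An element of Ext is an isomorphism class, as a predicate on extensions
   (classical_sets.set does not fit here, for universe reasons). *)
Definition Ext (A : rRB k) (M : rRB_rep A) : Type :=
  let T := {E : ab_ext A (rr_S M) | ext_induces E} in
  {X : T -> Prop | exists E : T, X = fun E' => ext_iso (sval E) (sval E')}.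

End AbelianExtension.

Section LeibnizDifferential.
Variables (k : fieldType) (U N : lmodType k).
Variables (m : U -> U -> U) (ml : U -> N -> N) (mr : N -> U -> N).

(* Indices start at 0, which shifts the exponents in (-1)^(i+1) and (-1)^i. *)
Definition leib_diff (n : nat) (c : ('I_n -> U) -> N) (x : 'I_n.+1 -> U) : N :=
  \sum_(i < n.+1 | (i < n)%N) (-1) ^+ i *: ml (x i) (c (fun q => x (lift i q)))
  + (-1) ^+ n.+1 *: mr (c (fun q => x (lift ord_max q))) (x ord_max)
  + \sum_(i < n.+1) \sum_(j < n.+1 | (i < j)%N) (-1) ^+ i.+1 *:
      c (fun q => if lift i q == j then m (x i) (x j) else x (lift i q)).

End LeibnizDifferential.

Definition multilinear (k : fieldType) (n : nat) (U N : lmodType k)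
    (f : ('I_n -> U) -> N) : Prop :=
  forall (i : 'I_n) (x : 'I_n -> U),
    linear (fun u => f (fun q => if q == i then u else x q)).

Section Cohomology.
Variables (k : fieldType) (A : rRB k) (M : rRB_rep A).
Local Notation g := (rrb_g A).
Local Notation V := (rrb_V A).
Local Notation R := (rrb_R A).
Local Notation h := (rr_h M).
Local Notation W := (rr_W M).
Local Notation S := (rr_S M).

(* The operation x . y on homogeneous elements is the restriction of these
   operations on g (+) V and h (+) W. *)
Definition gV_mul (x y : g * V) : g * V :=
  (brk x.1 y.1, actl x.1 y.2 + actr x.2 y.1).
Definition gV_l (x : g * V) (m : h * W) : h * W :=
  (actl x.1 m.1, actl x.1 m.2 + rr_l M x.2 m.1).
Definition gV_r (m : h * W) (x : g * V) : h * W :=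
  (actr m.1 x.1, actr m.2 x.1 + rr_r M m.1 x.2).

(* Triples (alpha, beta, gamma); beta i is the component of beta on the summand
   of g^{n-1,1} whose i-th factor is V, and takes the n-1 arguments in g (in
   order) followed by the argument in V. Multilinearity and the vanishing
   conditions in degrees 0 and 1 are imposed by is_cochain. *)
Definition cochain (n : nat) : Type :=
  ((('I_n -> g) -> h) * ('I_n -> ('I_n.-1 -> g) -> V -> W)
   * (('I_n.-1 -> V) -> h))%type.

Definition is_cochain (n : nat) (c : cochain n) : Prop :=
  [/\ multilinear c.1.1,
      forall i, (forall x, linear (c.1.2 i x)) /\
                (forall v, multilinear (fun x => c.1.2 i x v)),
      multilinear c.2,
      n = 0%N -> c.1.1 = 0 &
      (n <= 1)%N -> c.2 = 0].

(* alpha + beta, with values in h (+) W. *)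
Definition gV_cochain (n : nat) (a : ('I_n -> g) -> h)
    (b : 'I_n -> ('I_n.-1 -> g) -> V -> W) (x : 'I_n -> g * V) : h * W :=
  (a (fun q => (x q).1), \sum_(i < n) b i (fun q => (x (lift i q)).1) (x i).2).

Definition gV_args (n : nat) (i : 'I_n.+1) (x : 'I_n -> g) (v : V)
    (q : 'I_n.+1) : g * V :=
  if unlift i q is Some q' then (x q', 0) else (0, v).

Definition diff_alpha (n : nat) (a : ('I_n -> g) -> h) : ('I_n.+1 -> g) -> h :=
  leib_diff brk actl actr a.

Definition diff_beta (n : nat) (a : ('I_n -> g) -> h)
    (b : 'I_n -> ('I_n.-1 -> g) -> V -> W)
    : 'I_n.+1 -> ('I_n -> g) -> V -> W :=
  fun i x v => (leib_diff gV_mul gV_l gV_r (gV_cochain a b) (gV_args i x v)).2.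

Definition lR (v : V) (y : h) : h := actl (R v) y - S (rr_l M v y).
Definition rR (y : h) (v : V) : h := actr y (R v) - S (rr_r M y v).
Definition brR (v v' : V) : V := actl (R v) v' + actr v (R v').

Definition diff_gamma (n : nat) : (('I_n.-1 -> V) -> h) -> ('I_n -> V) -> h :=
  match n with
  | 0 => fun _ _ => 0
  | n'.+1 => fun c => leib_diff brR lR rR c
  end.

Definition h_R (n : nat) (a : ('I_n -> g) -> h)
    (b : 'I_n -> ('I_n.-1 -> g) -> V -> W) (v : 'I_n -> V) : h :=
  (-1) ^+ n *: (a (fun q => R (v q))
                - \sum_(i < n) S (b i (fun q => R (v (lift i q))) (v i))).

Definition dRB (n : nat) (c : cochain n) : cochain n.+1 :=
  (diff_alpha c.1.1, diff_beta c.1.1 c.1.2,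
   fun v => diff_gamma c.2 v + h_R c.1.1 c.1.2 v).

Definition cocycle (n : nat) (c : cochain n) : Prop :=
  is_cochain c /\ dRB c = 0.

Definition coboundary (n : nat) : cochain n -> Prop :=
  match n with
  | 0 => fun c => c = 0
  | n'.+1 => fun c => exists b : cochain n', is_cochain b /\ c = dRB b
  end.

(* The set of cosets z + B^n with z in Z^n. *)
Definition cohomology (n : nat) : Type :=
  {X : set (cochain n) | exists z : cochain n,
    cocycle z /\ X = [set c | coboundary (c - z)]}.

End Cohomology.

(* Main.v *)
(** Choosing linear sections s and t of an extension identifies its spaces with
    g (+) h and V (+) W, and measures by a 2-cochain (al, bl + br, ga) how far s
    and t are from preserving the bracket, the two actions and the operator R.
    The Leibniz, representation and Rota-Baxter identities of the extension are
    then exactly the cocycle equations, the extension can be rebuilt from the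
    cocycle on the direct sums, and an isomorphism of extensions is the same as
    a pair of linear maps g -> h, V -> W whose coboundary is the difference of
    the two cocycles. *)
Require Import Defs.
From HB Require Import structures.
From mathcomp Require Import all_boot all_order all_algebra.
From mathcomp Require Import boolp classical_sets functions.

Set Implicit Arguments.
Unset Strict Implicit.
Unset Printing Implicit Defensive.

Import GRing.Theory.
Local Open Scope ring_scope.

(** * Identities in abelian groups *)

(** Proof by reflection for identities in an abelian group: an expression in atoms is determined by
    its integer coefficients, so an identity reduces to a finite computation. *)
Inductive zexpr := ZVar of nat | ZZero | ZAdd of zexpr & zexpr | ZOpp of zexpr.

Fixpoint zeval (V : zmodType) (env : seq V) (e : zexpr) : V :=
  match e with
  | ZVar n => env`_n
  | ZZero => 0
  | ZAdd a b => zeval env a + zeval env b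
  | ZOpp a => - zeval env a
  end.

Fixpoint zcoef (e : zexpr) (i : nat) : int :=
  match e with
  | ZVar n => if i == n then 1 else 0
  | ZZero => 0
  | ZAdd a b => zcoef a i + zcoef b i
  | ZOpp a => - zcoef a i
  end.

Lemma zevalE (V : zmodType) (env : seq V) (e : zexpr) :
  zeval env e = \sum_(i < size env) env`_i *~ zcoef e i.
Proof.
elim: e => [n||a IHa b IHb|a IHa] /=.
- have [lt_n|le_n] := ltnP n (size env).
    rewrite (bigD1 (Ordinal lt_n)) //= eqxx mulr1z big1 ?addr0 // => i.
    by rewrite -val_eqE /= => /negbTE ->; rewrite mulr0z.
  rewrite nth_default // big1 // => i _.
  by rewrite ltn_eqF ?mulr0z // (leq_trans (ltn_ord i)).
- by rewrite big1 // => i _; rewrite mulr0z.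
- by rewrite IHa IHb -big_split /=; apply: eq_bigr => i _; rewrite mulrzDr.
- by rewrite IHa -sumrN; apply: eq_bigr => i _; rewrite mulrNz.
Qed.

Lemma zeval_eq (V : zmodType) (env : seq V) (e1 e2 : zexpr) :
  all (fun i => zcoef e1 i == zcoef e2 i) (iota 0 (size env)) ->
  zeval env e1 = zeval env e2.
Proof.
move=> /allP eq_coef; rewrite !zevalE; apply: eq_bigr => i _.
by rewrite (eqP (eq_coef i _)) // mem_iota /=.
Qed.

(* Atoms are compared up to unification, as rewriting leaves behind terms that
   differ in the canonical structures from which their operations come. *)
Ltac zindex x env :=
  match env with
  | ?y :: _ => let _ := match goal with _ => unify x y end in constr:(0%N)
  | _ :: ?env' => let n := zindex x env' in constr:(n.+1)
  end.

Ltac zinsert x env :=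
  match env with
  | _ => let _ := zindex x env in env
  | _ => constr:(x :: env)
  end.

Ltac zatoms env e :=
  lazymatch e with
  | ?a + ?b => let env' := zatoms env a in zatoms env' b
  | - ?a => zatoms env a
  | 0 => env
  | _ => zinsert e env
  end.

Ltac zreify env e :=
  lazymatch e with
  | ?a + ?b =>
      let a' := zreify env a in let b' := zreify env b in constr:(ZAdd a' b')
  | - ?a => let a' := zreify env a in constr:(ZOpp a')
  | 0 => constr:(ZZero)
  | _ => let n := zindex e env in constr:(ZVar n)
  end.

(** Anything other than a sum, an opposite or zero counts as an atom, so bilinearity has to be
    expanded before the call. *)
Ltac zmodule :=
  lazymatch goal with
  | |- @eq ?T ?a ?b =>
      let env0 := zatoms (@nil T) a in
      let env := zatoms env0 b in
      let a' := zreify env a in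
      let b' := zreify env b in
      apply: (@zeval_eq _ env a' b'); vm_compute; reflexivity
  end.

(** * Cochains of degree at most 2 *)

Section Vectors.
Variable T : Type.

Definition vec1 (a : T) : 'I_1 -> T := fun=> a.
(** The default value of [nth] is never reached, here and in [vec3], as the index lies below the
    length. *)
Definition vec2 (a b : T) : 'I_2 -> T := fun q => nth a [:: a; b] q.
Definition vec3 (a b c : T) : 'I_3 -> T := fun q => nth a [:: a; b; c] q.

Lemma vec0E (x y : 'I_0 -> T) : x = y.
Proof. by apply: funext => -[]. Qed.

Lemma vec1E (x : 'I_1 -> T) : x = vec1 (x ord0).
Proof. by apply: funext => q; rewrite [q]ord1. Qed.

Lemma vec2E (x : 'I_2 -> T) : x = vec2 (x ord0) (x ord_max).
Proof. by apply: funext => -[[|[|q]] Hq] //=; congr x; apply: val_inj. Qed.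

Lemma vec3E (x : 'I_3 -> T) :
  x = vec3 (x ord0) (x (lift ord0 ord0)) (x ord_max).
Proof. by apply: funext => -[[|[|[|q]]] Hq] //=; congr x; apply: val_inj. Qed.

End Vectors.

Section LeibnizDifferential.
Variables (k : fieldType) (U N : lmodType k).
Variables (m : U -> U -> U) (ml : U -> N -> N) (mr : N -> U -> N).

(** Both sums are empty in degree 0, and the right action carries the sign -1. The family [x0] is
    arbitrary, since all families on ['I_0] are equal. *)
Lemma leib_diff0E (c : ('I_0 -> U) -> N) (x0 : 'I_0 -> U) x :
  leib_diff m ml mr c (vec1 x) = - mr (c x0) x.
Proof.
rewrite /leib_diff big_mkcond; under [X in _ + X]eq_bigr do rewrite big_mkcond.
rewrite !(big_ord_recl, big_ord0) /= expr1 scaleN1r !(addr0, add0r).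
by congr (- mr (c _) _); apply: vec0E.
Qed.

Lemma leib_diff1E (c : ('I_1 -> U) -> N) x y :
  leib_diff m ml mr c (vec2 x y) =
  ml x (c (vec1 y)) + mr (c (vec1 x)) y - c (vec1 (m x y)).
Proof.
rewrite /leib_diff big_mkcond; under [X in _ + X]eq_bigr do rewrite big_mkcond.
rewrite !(big_ord_recl, big_ord0) /=.
rewrite !(expr0, expr1, sqrrN, expr1n, scale1r, scaleN1r, addr0, add0r) /=.
congr (ml _ (c _) + mr (c _) _ - c _); exact: vec1E.
Qed.

Lemma leib_diff2E (c : ('I_2 -> U) -> N) x y z :
  leib_diff m ml mr c (vec3 x y z) =
  ml x (c (vec2 y z)) - ml y (c (vec2 x z)) - mr (c (vec2 x y)) z
  - c (vec2 (m x y) z) - c (vec2 y (m x z)) + c (vec2 x (m y z)).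
Proof.
rewrite /leib_diff big_mkcond; under [X in _ + X]eq_bigr do rewrite big_mkcond.
rewrite !(big_ord_recl, big_ord0) /=.
rewrite !(expr0, exprS, mulr1, mulN1r, opprK, scale1r, scaleN1r, addr0, add0r).
rewrite /= !addrA.
congr (ml _ (c _) - ml _ (c _) - mr (c _) _ - c _ - c _ + c _);
  exact: vec2E.
Qed.

End LeibnizDifferential.

Lemma multilinear1P (k : fieldType) (U N : lmodType k) (f : ('I_1 -> U) -> N) :
  multilinear f <-> linear (fun a => f (vec1 a)).
Proof.
have vecE u x : (fun q : 'I_1 => if q == ord0 then u else x q) =
    vec1 u :> ('I_1 -> U).
  by apply: funext => q; rewrite [q]ord1.
split=> [f_lin a u v|f_lin i x a u v].
  by have := f_lin ord0 (vec1 u) a u v; rewrite !vecE.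
by rewrite [i]ord1 !vecE f_lin.
Qed.

Lemma multilinear2P (k : fieldType) (U N : lmodType k) (f : ('I_2 -> U) -> N) :
  multilinear f <->
  (forall b, linear (fun a => f (vec2 a b))) /\
  (forall a, linear (fun b => f (vec2 a b))).
Proof.
have upd0 u x : (fun q : 'I_2 => if q == ord0 then u else x q) =
    vec2 u (x ord_max) :> ('I_2 -> U) by rewrite [LHS]vec2E.
have upd1 u x : (fun q : 'I_2 => if q == ord_max then u else x q) =
    vec2 (x ord0) u :> ('I_2 -> U) by rewrite [LHS]vec2E.
split=> [f_lin|[f_lin0 f_lin1] i x a u v].
  split=> b a u v.
    by have := f_lin ord0 (vec2 u b) a u v; rewrite !upd0.
  by have := f_lin ord_max (vec2 b u) a u v; rewrite !upd1.
have [->|->] : i = ord0 \/ i = ord_max.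
- by case: i => -[|[|//]] ?; [left|right]; apply: val_inj.
- by rewrite !upd0 f_lin0.
- by rewrite !upd1 f_lin1.
Qed.

Section Cochains.
Variables (k : fieldType) (A : rRB k) (M : rRB_rep A).
Local Notation g := (rrb_g A).
Local Notation V := (rrb_V A).
Local Notation R := (rrb_R A).
Local Notation h := (rr_h M).
Local Notation W := (rr_W M).
Local Notation S := (rr_S M).

Definition cochain1 (phi : g -> h) (psi : V -> W) : cochain M 1 :=
  (fun x => phi (x ord0), fun=> fun=> psi, 0).

Definition cochain2 (al : g -> g -> h) (bl : g -> V -> W) (br : V -> g -> W)
    (ga : V -> h) : cochain M 2 :=
  (fun x => al (x ord0) (x ord_max),
   fun i x v => if i == ord0 then br v (x ord0) else bl (x ord0) v,
   fun v => ga (v ord0)).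

(* The component of beta on V (x) g has index 0, the one on g (x) V index 1;
   both take their argument in g first. *)
Definition c_gg (c : cochain M 2) x y := c.1.1 (vec2 x y).
Definition c_gV (c : cochain M 2) x v := c.1.2 ord_max (vec1 x) v.
Definition c_Vg (c : cochain M 2) v x := c.1.2 ord0 (vec1 x) v.
Definition c_V (c : cochain M 2) v := c.2 (vec1 v).

Lemma eq_cochain2 (c c' : cochain M 2) :
  (forall x y, c_gg c x y = c_gg c' x y) ->
  (forall x v, c_gV c x v = c_gV c' x v) ->
  (forall v x, c_Vg c v x = c_Vg c' v x) ->
  (forall v, c_V c v = c_V c' v) -> c = c'.
Proof.
case: c c' => [[a b] d] [[a' b'] d'] eq_gg eq_gV eq_Vg eq_V.
congr (_, _, _); apply: funext => x.
- by rewrite [x]vec2E; apply: eq_gg.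
- apply: funext => y; apply: funext => v; rewrite [y]vec1E.
  have [->|->] : x = ord0 \/ x = ord_max; last exact: eq_gV; last exact: eq_Vg.
  by case: x => -[|[|//]] ?; [left|right]; apply: val_inj.
- by rewrite [x]vec1E; apply: eq_V.
Qed.

Lemma is_cochain2P (c : cochain M 2) :
  is_cochain c <->
  [/\ (forall y, linear (c_gg c ^~ y)) /\ (forall x, linear (c_gg c x)),
      (forall v, linear (c_gV c ^~ v)) /\ (forall x, linear (c_gV c x)),
      (forall x, linear (c_Vg c ^~ x)) /\ (forall v, linear (c_Vg c v)) &
      linear (c_V c)].
Proof.
split=> [[/multilinear2P lin_gg lin_b /multilinear1P lin_V _ _]|].
  have [lin_r lin_lr] := lin_b ord0; have [lin_l lin_ll] := lin_b ord_max.
  split=> //; split=> u.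
  - exact: (iffLR (multilinear1P _) (lin_ll u)).
  - exact: (lin_l (vec1 u)).
  - exact: (lin_r (vec1 u)).
  - exact: (iffLR (multilinear1P _) (lin_lr u)).
move=> [/multilinear2P lin_gg [lin_gV1 lin_gV2] [lin_Vg1 lin_Vg2]].
move=> /multilinear1P lin_V; split=> // i.
have [->|->] : i = ord0 \/ i = ord_max.
- by case: i => -[|[|//]] ?; [left|right]; apply: val_inj.
- split=> [x|v]; first by rewrite [x]vec1E; apply: lin_Vg1.
  exact: (iffRL (multilinear1P _) (lin_Vg2 v)).
- split=> [x|v]; first by rewrite [x]vec1E; apply: lin_gV2.
  exact: (iffRL (multilinear1P _) (lin_gV1 v)).
Qed.

(** A cochain carries multilinearity as a proposition, whereas the extension is built from bundled
    bilinear maps; this passes from one to the other. *)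
Lemma is_cochain2_bilinear (c : cochain M 2) : is_cochain c ->
  exists (al : {bilinear g -> g -> h}) (bl : {bilinear g -> V -> W})
         (br : {bilinear V -> g -> W}) (ga : {linear V -> h}),
    c = cochain2 al bl br ga.
Proof.
move=> /is_cochain2P[gg gV Vg lin_V].
pose al : {bilinear g -> g -> h} :=
  HB.pack (c_gg c) (bilinear_isBilinear.Build _ _ _ _ *:%R *:%R (c_gg c)
    (pair (proj1 gg) (proj2 gg))).
pose bl : {bilinear g -> V -> W} :=
  HB.pack (c_gV c) (bilinear_isBilinear.Build _ _ _ _ *:%R *:%R (c_gV c)
    (pair (proj1 gV) (proj2 gV))).
pose br : {bilinear V -> g -> W} :=
  HB.pack (c_Vg c) (bilinear_isBilinear.Build _ _ _ _ *:%R *:%R (c_Vg c)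
    (pair (proj1 Vg) (proj2 Vg))).
pose ga : {linear V -> h} :=
  HB.pack (c_V c) (GRing.isLinear.Build _ _ _ _ (c_V c) lin_V).
by exists al, bl, br, ga; apply: eq_cochain2.
Qed.

Lemma gV_cochain2E (c : cochain M 2) X Y :
  gV_cochain c.1.1 c.1.2 (vec2 X Y) =
  (c_gg c X.1 Y.1, c_Vg c X.2 Y.1 + c_gV c X.1 Y.2).
Proof.
rewrite /gV_cochain !big_ord_recl big_ord0 addr0 /=; congr (c.1.1 _, _).
  exact: vec2E.
congr (c.1.2 ord0 _ _ + _); first exact: vec1E.
by rewrite [X in c.1.2 _ X]vec1E; congr (c.1.2 _ _ _); apply: val_inj.
Qed.

Lemma gV_args0 (x y : g) (v : V) :
  gV_args ord0 (vec2 x y) v = vec3 (0, v) (x, 0) (y, 0).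
Proof.
have E : ord_max = lift ord0 ord_max :> 'I_3 by apply: val_inj.
by rewrite [LHS]vec3E /gV_args unlift_none E !liftK.
Qed.

Lemma gV_args1 (x y : g) (v : V) :
  gV_args (lift ord0 ord0) (vec2 x y) v = vec3 (x, 0) (0, v) (y, 0).
Proof.
have E0 : ord0 = lift (lift ord0 ord0) ord0 :> 'I_3 by apply: val_inj.
have E1 : ord_max = lift (lift ord0 ord0) ord_max :> 'I_3 by apply: val_inj.
by rewrite [LHS]vec3E /gV_args unlift_none E1 [X in unlift _ X]E0 !liftK.
Qed.

Lemma gV_args2 (x y : g) (v : V) :
  gV_args ord_max (vec2 x y) v = vec3 (x, 0) (y, 0) (0, v).
Proof.
have E0 : ord0 = lift ord_max ord0 :> 'I_3 by apply: val_inj.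
have E1 : lift ord0 ord0 = lift ord_max ord_max :> 'I_3 by apply: val_inj.
by rewrite [LHS]vec3E /gV_args unlift_none E1 E0 !liftK.
Qed.

(** * The cocycle equations in degree 2 *)

Section Cocycle.
Variable c : cochain M 2.
Hypothesis c_cochain : is_cochain c.

(** Embedding [g] and [V] into [g * V] pads the arguments with zeros; these identities remove the
    resulting terms from the differential. *)
Let c0 : [/\ (forall y, c_gg c 0 y = 0) /\ (forall x, c_gg c x 0 = 0),
      (forall v, c_gV c 0 v = 0) /\ (forall x, c_gV c x 0 = 0) &
      (forall x, c_Vg c 0 x = 0) /\ (forall v, c_Vg c v 0 = 0)].
Proof.
have [al [bl [br [ga ->]]]] := is_cochain2_bilinear c_cochain.
by split; split=> u; first [exact: linear0l | exact: linear0r].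
Qed.

(** After the equation on [g] alone come those with the argument of [V] first, second and last, then
    the one on [V] alone. In this order they encode the Leibniz identity, the laws [actrrP],
    [actlrP], [actllP] and the Rota-Baxter identity of the extension. *)
Definition cocycle_eqs := [/\
  (forall x y z, actl x (c_gg c y z) - actl y (c_gg c x z)
    - actr (c_gg c x y) z - c_gg c (brk x y) z - c_gg c y (brk x z)
    + c_gg c x (brk y z) = 0),
  (forall v y z, rr_l M v (c_gg c y z) - actl y (c_Vg c v z)
    - actr (c_Vg c v y) z - c_Vg c (actr v y) z - c_gV c y (actr v z)
    + c_Vg c v (brk y z) = 0),
  (forall x v z, actl x (c_Vg c v z) - rr_l M v (c_gg c x z)
    - actr (c_gV c x v) z - c_Vg c (actl x v) z - c_Vg c v (brk x z)
    + c_gV c x (actr v z) = 0),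
  (forall x y v, actl x (c_gV c y v) - actl y (c_gV c x v)
    - rr_r M (c_gg c x y) v - c_gV c (brk x y) v - c_gV c y (actl x v)
    + c_gV c x (actl y v) = 0) &
  (forall v w, lR v (c_V c w) + rR (c_V c v) w - c_V c (brR v w)
    + (c_gg c (R v) (R w) - S (c_Vg c v (R w) + c_gV c (R v) w)) = 0)].

(** Each equation is a value of [dRB c] at an explicit tuple, and these values determine [dRB c]
    because every family of two or three arguments is a [vec2] or a [vec3]. *)
Lemma cocycle2P : cocycle c <-> cocycle_eqs.
Proof.
have [[gg0l gg0r] [gV0l gV0r] [Vg0l Vg0r]] := c0.
have simp0 := (@linear0l, @linear0r, gV0l, gV0r, Vg0l, Vg0r, gg0l, gg0r,
  addr0, add0r, oppr0).
have diff0 v y z : diff_beta c.1.1 c.1.2 ord0 (vec2 y z) v =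
    rr_l M v (c_gg c y z) - actl y (c_Vg c v z)
    - actr (c_Vg c v y) z - c_Vg c (actr v y) z - c_gV c y (actr v z)
    + c_Vg c v (brk y z).
  by rewrite /diff_beta gV_args0 leib_diff2E !gV_cochain2E /= !simp0.
have diff1 x v z : diff_beta c.1.1 c.1.2 (lift ord0 ord0) (vec2 x z) v =
    actl x (c_Vg c v z) - rr_l M v (c_gg c x z)
    - actr (c_gV c x v) z - c_Vg c (actl x v) z - c_Vg c v (brk x z)
    + c_gV c x (actr v z).
  by rewrite /diff_beta gV_args1 leib_diff2E !gV_cochain2E /= !simp0.
have diff2 x y v : diff_beta c.1.1 c.1.2 ord_max (vec2 x y) v =
    actl x (c_gV c y v) - actl y (c_gV c x v)
    - rr_r M (c_gg c x y) v - c_gV c (brk x y) v - c_gV c y (actl x v)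
    + c_gV c x (actl y v).
  by rewrite /diff_beta gV_args2 leib_diff2E !gV_cochain2E /= !simp0.
have diffV v w : diff_gamma c.2 (vec2 v w) + h_R c.1.1 c.1.2 (vec2 v w) =
    lR v (c_V c w) + rR (c_V c v) w - c_V c (brR v w)
    + (c_gg c (R v) (R w) - S (c_Vg c v (R w) + c_gV c (R v) w)).
  rewrite /diff_gamma leib_diff1E /h_R sqrrN expr1n scale1r.
  rewrite !big_ord_recl big_ord0 addr0 -linearD.
  congr (_ + (c.1.1 _ - S (c.1.2 _ _ _ + c.1.2 _ _ _))).
  - exact: vec2E.
  - exact: vec1E.
  - exact: val_inj.
  - exact: vec1E.
split=> [[_ [dgg dB dV]]|[Egg EVg EgVg EgV EV]].
  split=> [x y z|v y z|x v z|x y v|v w].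
  - rewrite -leib_diff2E; exact: (congr1 (@^~ (vec3 x y z)) dgg).
  - by rewrite -diff0 dB.
  - by rewrite -diff1 dB.
  - by rewrite -diff2 dB.
  - rewrite -diffV; exact: (congr1 (@^~ (vec2 v w)) dV).
split=> //; congr (_, _, _); apply: funext => x.
- by rewrite [x]vec3E /diff_alpha leib_diff2E Egg.
- apply: funext => y; apply: funext => v; rewrite [y]vec2E.
  have [->|[->|->]] : x = ord0 \/ x = lift ord0 ord0 \/ x = ord_max.
  + case: x => -[|[|[|//]]] ?; [left|right; left|right; right]; exact: val_inj.
  + by rewrite diff0 EVg.
  + by rewrite diff1 EgVg.
  + by rewrite diff2 EgV.
- by rewrite [x]vec2E diffV EV.
Qed.

End Cocycle.

(** * Coboundaries in degree 2 *)

Lemma is_cochain1 (phi : {linear g -> h}) (psi : {linear V -> W}) :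
  is_cochain (cochain1 phi psi).
Proof.
split=> //.
- by apply/multilinear1P => a x y /=; rewrite linearP.
- move=> i; split=> [? a x y|v j]; first by rewrite /= linearP.
  by have := ltn_ord j.
- by case.
Qed.

Lemma cochain1_linear (b : cochain M 1) : is_cochain b ->
  exists (phi : {linear g -> h}) (psi : {linear V -> W}), b = cochain1 phi psi.
Proof.
case: b => [[a b] d] [/= /multilinear1P lin_a lin_b _ _ d0].
pose phi : {linear g -> h} :=
  HB.pack (fun x => a (vec1 x)) (GRing.isLinear.Build _ _ _ _ _ lin_a).
have [lin_psi _] := lin_b ord0.
pose v0 : 'I_0 -> g := fun=> 0.
pose psi : {linear V -> W} :=
  HB.pack (b ord0 v0) (GRing.isLinear.Build _ _ _ _ _ (lin_psi v0)).
exists phi, psi; congr (_, _, _); last exact: d0.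
  by apply: funext => x; rewrite [x]vec1E.
by apply: funext => i; apply: funext => x; rewrite [i]ord1 (vec0E x v0).
Qed.

(** These are the formulas of the differential in degree 1; the signs in the last equation come from
    the factor [(-1) ^+ n] of [h_R] at [n = 1]. *)
Definition cobounds (c : cochain M 2) (phi : g -> h) (psi : V -> W) := [/\
  (forall x y, c_gg c x y = actl x (phi y) + actr (phi x) y - phi (brk x y)),
  (forall x v, c_gV c x v = actl x (psi v) + rr_r M (phi x) v - psi (actl x v)),
  (forall v x,
     c_Vg c v x = rr_l M v (phi x) + actr (psi v) x - psi (actr v x)) &
  (forall v, c_V c v = S (psi v) - phi (R v))].

Lemma dRB_cochain1 (phi : {linear g -> h}) (psi : {linear V -> W}) :
  cobounds (dRB (cochain1 phi psi)) phi psi.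
Proof.
have args0 (x : g) (v : V) : gV_args ord0 (vec1 x) v = vec2 (0, v) (x, 0).
  have E : ord_max = lift ord0 ord_max :> 'I_2 by apply: val_inj.
  by rewrite [LHS]vec2E /gV_args unlift_none E !liftK.
have args1 (x : g) (v : V) : gV_args ord_max (vec1 x) v = vec2 (x, 0) (0, v).
  have E : ord0 = lift ord_max ord0 :> 'I_2 by apply: val_inj.
  by rewrite [LHS]vec2E /gV_args unlift_none E !liftK.
have gV1E X :
    gV_cochain (cochain1 phi psi).1.1 (cochain1 phi psi).1.2 (vec1 X) =
    (phi X.1, psi X.2).
  by rewrite /gV_cochain big_ord_recl big_ord0 addr0.
have simp0 := (@linear0l, @linear0r, addr0, add0r, oppr0).
split=> [x y|x v|v x|v].
- by rewrite /c_gg /= /diff_alpha leib_diff1E.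
- by rewrite /c_gV /= /diff_beta args1 leib_diff1E !gV1E /= !simp0.
- by rewrite /c_Vg /= /diff_beta args0 leib_diff1E !gV1E /= !simp0.
(* The third component is zero in degree 1, so the term in [rR] vanishes and only [h_R] remains. *)
- rewrite /c_V /= /diff_gamma (leib_diff0E _ _ _ _ (fun=> 0)) /rR /h_R /=.
  rewrite big_ord_recl big_ord0 expr1 scaleN1r linear0l linear0l linear0 /vec1.
  zmodule.
Qed.

Lemma coboundary2P (c : cochain M 2) : coboundary c <->
  exists (phi : {linear g -> h}) (psi : {linear V -> W}), cobounds c phi psi.
Proof.
split=> [[_ [/cochain1_linear [phi [psi ->]] ->]]|[phi [psi [Egg EgV EVg EV]]]].
  by exists phi, psi; apply: dRB_cochain1.
exists (cochain1 phi psi); split; first exact: is_cochain1.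
have [Dgg DgV DVg DV] := dRB_cochain1 phi psi.
apply: eq_cochain2 => *.
- by rewrite Egg Dgg.
- by rewrite EgV DgV.
- by rewrite EVg DVg.
- by rewrite EV DV.
Qed.

Lemma coboundary2_0 : coboundary (0 : cochain M 2).
Proof.
apply/coboundary2P; exists \0, \0.
split=> *; rewrite /= ?(linear0l, linear0r, linear0, addr0, subr0) //.
Qed.

(** The primitives subtract. Together with [coboundary2_0] this makes being cohomologous an
    equivalence relation. *)
Lemma coboundary2B (c c' : cochain M 2) :
  coboundary c -> coboundary c' -> coboundary (c - c').
Proof.
move=> /coboundary2P[phi [psi [Egg EgV EVg EV]]].
move=> /coboundary2P[phi' [psi' [Egg' EgV' EVg' EV']]].
apply/coboundary2P; exists (phi \- phi'), (psi \- psi').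
split=> [x y|x v|v x|v].
- transitivity (c_gg c x y - c_gg c' x y) => //.
  rewrite Egg Egg' /= linearBr linearBl; zmodule.
- transitivity (c_gV c x v - c_gV c' x v) => //.
  rewrite EgV EgV' /= linearBr linearBl; zmodule.
- transitivity (c_Vg c v x - c_Vg c' v x) => //.
  rewrite EVg EVg' /= linearBr linearBl; zmodule.
- transitivity (c_V c v - c_V c' v) => //.
  rewrite EV EV' /= (linearB S); zmodule.
Qed.

End Cochains.

(** * The cocycle of an extension *)

Section ShortExact.
Variables (k : fieldType) (X Y Z : lmodType k).
Variables (i : {linear X -> Y}) (p : {linear Y -> Z}).
Hypothesis exact_ip : short_exact i p.

Lemma short_exact_inj : injective i.
Proof. by case: exact_ip. Qed.

Lemma short_exact0 x : p (i x) = 0.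
Proof.
have [_ im_ker _] := exact_ip.
by have : (p @^-1` [set 0])%classic (i x) by rewrite -im_ker; exists x.
Qed.

(** Values killed by [p] lie in the image of [i], and choice picks preimages. The index type is
    free: a product serves for maps of two variables, and [unit] for a single element. *)
Lemma short_exact_lift (T : Type) (f : T -> Y) :
  (forall t, p (f t) = 0) -> exists a : T -> X, forall t, f t = i (a t).
Proof.
move=> pf0; have [_ im_ker _] := exact_ip.
suff /choice[a aE] : forall t, exists x, f t = i x by exists a.
move=> t.
have : range i (f t) by rewrite im_ker; apply: pf0.
by case=> x _ <-; exists x.
Qed.

(** Injectivity of [i] transfers linearity from [f] to its lift. *)
Lemma short_exact_lift_linear (U : lmodType k) (f : {linear U -> Y}) :
  (forall u, p (f u) = 0) ->
  exists a : {linear U -> X}, forall u, f u = i (a u).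
Proof.
move=> /short_exact_lift[a fE].
have a_lin : linear a.
  by move=> c u v; apply: short_exact_inj; rewrite linearP -!fE linearP.
pose a' : {linear U -> X} := HB.pack a (GRing.isLinear.Build _ _ _ _ _ a_lin).
by exists a'.
Qed.

End ShortExact.

(** This is the short five lemma with identities at both ends. *)
Lemma short_exact_bijective (k : fieldType) (X Y Y' Z : lmodType k)
    (i : {linear X -> Y}) (p : {linear Y -> Z})
    (i' : {linear X -> Y'}) (p' : {linear Y' -> Z}) (f : {linear Y -> Y'}) :
  short_exact i p -> short_exact i' p' ->
  (forall x, f (i x) = i' x) -> (forall y, p' (f y) = p y) -> bijective f.
Proof.
move=> ex ex' fi pf; have [_ _ p_surj] := ex.
have f_ker y : f y = 0 -> y = 0.
  move=> fy0; have [//|x yE] := short_exact_lift ex (f := fun _ : unit => y).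
    by rewrite -pf fy0 linear0.
  apply/eqP; rewrite (yE tt) -(linear0 i) (inj_eq (short_exact_inj ex)).
  by rewrite -(inj_eq (short_exact_inj ex')) -fi -yE fy0 linear0.
have f_inj : injective f.
  by move=> y y' /eqP; rewrite -subr_eq0 -linearB => /eqP /f_ker /subr0_eq.
have [g fgK] : exists g, forall y', f (g y') = y'.
  suff /choice[g gE] : forall y', exists y, f y = y' by exists g.
  move=> y'.
  have [y _ py] : range p (p' y') by rewrite p_surj.
  (* The elements [y'] and [f y] have the same image under [p'], so they differ by some [i' x], and
     adding [i x] to [y] corrects the difference. *)
  have [//|x y'E] := short_exact_lift ex' (f := fun _ : unit => y' - f y).
    by rewrite linearB pf py subrr.
  by exists (y + i (x tt)); rewrite linearD fi -y'E addrC subrK.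
by exists g => // y; apply: f_inj; rewrite fgK.
Qed.

Section Presentations.
Variables (k : fieldType) (A : rRB k) (M : rRB_rep A).
Local Notation g := (rrb_g A).
Local Notation V := (rrb_V A).
Local Notation R := (rrb_R A).
Local Notation h := (rr_h M).
Local Notation W := (rr_W M).
Local Notation S := (rr_S M).
Local Notation ext := (ab_ext A S).

(** The source is written [h] instead of the convertible [rrb_g (complex_rRB S)], so that values of
    the operations of [M] can be fed in directly; [ext_iW] does the same for [W]. *)
Definition ext_ih (E : ext) : {linear h -> rrb_g (ext_tot E)} :=
  mor_phi (ext_i E).
Definition ext_iW (E : ext) : {linear W -> rrb_V (ext_tot E)} :=
  mor_psi (ext_i E).
Local Notation pg E := (mor_phi (ext_p E)).
Local Notation pV E := (mor_psi (ext_p E)).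

Lemma exact_g (E : ext) : short_exact (ext_ih E) (pg E).
Proof. exact: ext_exact_g. Qed.

Lemma exact_V (E : ext) : short_exact (ext_iW E) (pV E).
Proof. exact: ext_exact_V. Qed.

Lemma brk_ih (E : ext) x y : brk (ext_ih E x) (ext_ih E y) = 0.
Proof.
by rewrite -(mor_br (ext_i E)) -(linear0 (mor_phi (ext_i E))).
Qed.

Lemma actl_ih (E : ext) x w : actl (ext_ih E x) (ext_iW E w) = 0.
Proof.
by rewrite -(mor_l (ext_i E)) -(linear0 (mor_psi (ext_i E))).
Qed.

Lemma actr_ih (E : ext) w x : actr (ext_iW E w) (ext_ih E x) = 0.
Proof.
by rewrite -(mor_r (ext_i E)) -(linear0 (mor_psi (ext_i E))).
Qed.

Lemma R_iW (E : ext) w : rrb_R (ext_tot E) (ext_iW E w) = ext_ih E (S w).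
Proof. by rewrite -(mor_R (ext_i E)). Qed.

(** The middle fields say that [s] and [t] induce the given representation, and the last four make
    [c] their defect. This is a relation and not a function of [E], since [c] depends on the
    sections. *)
Record presents (E : ext) (s : {linear g -> rrb_g (ext_tot E)})
    (t : {linear V -> rrb_V (ext_tot E)}) (c : cochain M 2) : Prop := Presents {
  pr_s : cancel s (pg E);
  pr_t : cancel t (pV E);
  pr_hl : forall x y, ext_ih E (actl x y) = brk (s x) (ext_ih E y);
  pr_hr : forall y x, ext_ih E (actr y x) = brk (ext_ih E y) (s x);
  pr_Wl : forall x w, ext_iW E (actl x w) = actl (s x) (ext_iW E w);
  pr_Wr : forall w x, ext_iW E (actr w x) = actr (ext_iW E w) (s x);
  pr_l : forall v y, ext_iW E (rr_l M v y) = actr (t v) (ext_ih E y);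
  pr_r : forall y v, ext_iW E (rr_r M y v) = actl (ext_ih E y) (t v);
  pr_gg : forall x y, ext_ih E (c_gg c x y) = brk (s x) (s y) - s (brk x y);
  pr_gV : forall x v, ext_iW E (c_gV c x v) = actl (s x) (t v) - t (actl x v);
  pr_Vg : forall v x, ext_iW E (c_Vg c v x) = actr (t v) (s x) - t (actr v x);
  pr_V : forall v, ext_ih E (c_V c v) = rrb_R (ext_tot E) (t v) - s (R v) }.

Lemma presents_induces (E : ext) s t c : @presents E s t c -> ext_induces E.
Proof. by case=> *; exists s, t. Qed.

(** The projection is a morphism split by [s] and [t], so it kills each defect, which therefore
    lifts along the inclusion. *)
Lemma induces_presents (E : ext) :
  ext_induces E -> exists s t c, @presents E s t c.
Proof.
case=> s [t [sK tK [hl hr] [Wl Wr] [l r]]].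
have [|al alE] := short_exact_lift (exact_g E)
    (f := fun xy => brk (s xy.1) (s xy.2) - s (brk xy.1 xy.2)).
  by move=> [x y]; rewrite linearB (mor_br (ext_p E)) !sK subrr.
have [|bl blE] := short_exact_lift (exact_V E)
    (f := fun xv => actl (s xv.1) (t xv.2) - t (actl xv.1 xv.2)).
  by move=> [x v]; rewrite linearB (mor_l (ext_p E)) sK !tK subrr.
have [|br brE] := short_exact_lift (exact_V E)
    (f := fun vx => actr (t vx.1) (s vx.2) - t (actr vx.1 vx.2)).
  by move=> [v x]; rewrite linearB (mor_r (ext_p E)) sK !tK subrr.
have [|ga gaE] := short_exact_lift (exact_g E)
    (f := fun v => rrb_R (ext_tot E) (t v) - s (R v)).
  by move=> v; rewrite linearB (mor_R (ext_p E)) sK !tK subrr.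
exists s, t, (cochain2 (fun x y => al (x, y)) (fun x v => bl (x, v))
  (fun v x => br (v, x)) ga).
split=> // [x y|x v|v x].
- exact: esym (alE (x, y)).
- exact: esym (blE (x, v)).
- exact: esym (brE (v, x)).
Qed.

Section PresentationFacts.
Variables (E : ext) (s : {linear g -> rrb_g (ext_tot E)}).
Variables (t : {linear V -> rrb_V (ext_tot E)}) (c : cochain M 2).
Hypothesis E_c : presents s t c.

(** As the inclusions are injective, linearity can be tested on the defects, which inherit it from
    the sections and the operations. *)
Lemma presents_cochain : is_cochain c.
Proof.
have inj_h := short_exact_inj (exact_g E).
have inj_W := short_exact_inj (exact_V E).
have lin := (@linearPl, @linearP, @scalerBr, @scalerN).
apply/is_cochain2P; split.
- split=> z a x y; apply: inj_h; rewrite [RHS]linearP /= !(pr_gg E_c);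
    rewrite !lin /= ?lin; zmodule.
- split=> z a x y; apply: inj_W; rewrite [RHS]linearP /= !(pr_gV E_c);
    rewrite !lin /= ?lin; zmodule.
- split=> z a x y; apply: inj_W; rewrite [RHS]linearP /= !(pr_Vg E_c);
    rewrite !lin /= ?lin; zmodule.
- move=> a x y; apply: inj_h; rewrite [RHS]linearP /= !(pr_V E_c).
  rewrite !lin /= ?lin; zmodule.
Qed.

(** Inside the extension, each of the first four equations is an identity of [E] at the sections
    minus the section of the same identity in [A]. The fifth combines the Rota-Baxter identities of
    [E] and [A] in the same way. *)
Lemma presents_cocycle : cocycle c.
Proof.
have inj_h := short_exact_inj (exact_g E).
have inj_W := short_exact_inj (exact_V E).
have dl := (@linearBl, @linearDl, @linearBr, @linearDr, @linearB, @linearD).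
apply: (iffRL (cocycle2P presents_cochain)); split.
- move=> x y z; apply: inj_h; rewrite linear0 !dl /=.
  rewrite !(pr_hl E_c, pr_hr E_c, pr_gg E_c) !dl /=.
  rewrite (brkP (s x) (s y) (s z)) (brkP x y z) !dl /=; zmodule.
- move=> v y z; apply: inj_W; rewrite linear0 !dl /=.
  rewrite !(pr_l E_c, pr_Wl E_c, pr_Wr E_c, pr_gg E_c, pr_gV E_c, pr_Vg E_c).
  rewrite !dl /= (actrrP (t v)) (actrrP v) !dl /=; zmodule.
- move=> x v z; apply: inj_W; rewrite linear0 !dl /=.
  rewrite !(pr_l E_c, pr_Wl E_c, pr_Wr E_c, pr_gg E_c, pr_gV E_c, pr_Vg E_c).
  rewrite !dl /= (actlrP (s x) (t v)) (actlrP x v) !dl /=; zmodule.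
- move=> x y v; apply: inj_W; rewrite linear0 !dl /=.
  rewrite !(pr_r E_c, pr_Wl E_c, pr_Wr E_c, pr_gg E_c, pr_gV E_c, pr_Vg E_c).
  rewrite !dl /= (actllP (s x) (s y)) (actllP x y) !dl /=; zmodule.
- move=> v w; apply: inj_h; rewrite linear0 /lR /rR /brR !dl /=.
  rewrite -!R_iW !(pr_l E_c, pr_r E_c, pr_hl E_c, pr_hr E_c).
  rewrite !(pr_gg E_c, pr_gV E_c, pr_Vg E_c, pr_V E_c) !dl /=.
  (* gamma v and gamma w lie in h, which is abelian. *)
  transitivity (- brk (rrb_R (ext_tot E) (t v) - s (R v))
                      (rrb_R (ext_tot E) (t w) - s (R w))); last first.
    by rewrite -!(pr_V E_c) brk_ih oppr0.
  by rewrite !dl /= (rrb_RP (t v)) (rrb_RP v) !dl /=; zmodule.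
Qed.

(* The coordinates along h and W in the splittings given by s and t. *)
Lemma presents_retraction :
  exists (r : {linear rrb_g (ext_tot E) -> h})
         (rV : {linear rrb_V (ext_tot E) -> W}),
    (forall y, y = s (pg E y) + ext_ih E (r y)) /\
    (forall w, w = t (pV E w) + ext_iW E (rV w)).
Proof.
have [|r rE] := short_exact_lift_linear (exact_g E)
    (f := idfun \- (s \o pg E)).
  by move=> y; rewrite linearB /= (pr_s E_c) subrr.
have [|rV rVE] := short_exact_lift_linear (exact_V E)
    (f := idfun \- (t \o pV E)).
  by move=> y; rewrite linearB /= (pr_t E_c) subrr.
by exists r, rV; split=> y; rewrite -?rE -?rVE /= addrC subrK.
Qed.

End PresentationFacts.

(** Both [mor_phi f \o s] and [s'] are sections of [E'], so their difference lifts to a map [phi]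
    into [h]; [psi] arises likewise from [t] and [t']. Comparing defects gives the coboundary
    equations. *)
Lemma ext_iso_coboundary (E E' : ext) s t c s' t' c' :
  @presents E s t c -> @presents E' s' t' c' ->
  ext_iso E E' -> coboundary (c - c').
Proof.
move=> E_c E_c' [f [_ _ [fi pf] [fiV pVf]]].
have inj_h := short_exact_inj (exact_g E').
have inj_W := short_exact_inj (exact_V E').
have [|phi phiE] := short_exact_lift_linear (exact_g E')
    (f := (mor_phi f \o s) \- s').
  by move=> x; rewrite linearB /= pf (pr_s E_c) (pr_s E_c') subrr.
have [|psi psiE] := short_exact_lift_linear (exact_V E')
    (f := (mor_psi f \o t) \- t').
  by move=> v; rewrite linearB /= pVf (pr_t E_c) (pr_t E_c') subrr.
have fs x : mor_phi f (s x) = s' x + ext_ih E' (phi x).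
  by rewrite -phiE /= addrC subrK.
have ft v : mor_psi f (t v) = t' v + ext_iW E' (psi v).
  by rewrite -psiE /= addrC subrK.
have dl := (@linearBl, @linearDl, @linearBr, @linearDr, @linearB, @linearD).
apply/coboundary2P; exists phi, psi; split.
- move=> x y; apply: inj_h.
  transitivity (mor_phi f (ext_ih E (c_gg c x y)) - ext_ih E' (c_gg c' x y)).
    by rewrite fi -linearB.
  rewrite !dl (pr_gg E_c) (pr_gg E_c') (pr_hl E_c') (pr_hr E_c') !dl mor_br !fs.
  rewrite !dl brk_ih /=; zmodule.
- move=> x v; apply: inj_W.
  transitivity (mor_psi f (ext_iW E (c_gV c x v)) - ext_iW E' (c_gV c' x v)).
    by rewrite fiV -linearB.
  rewrite !dl (pr_gV E_c) (pr_gV E_c') (pr_Wl E_c') (pr_r E_c') !dl mor_l.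
  rewrite fs !ft !dl actl_ih /=; zmodule.
- move=> v x; apply: inj_W.
  transitivity (mor_psi f (ext_iW E (c_Vg c v x)) - ext_iW E' (c_Vg c' v x)).
    by rewrite fiV -linearB.
  rewrite !dl (pr_Vg E_c) (pr_Vg E_c') (pr_Wr E_c') (pr_l E_c') !dl mor_r.
  rewrite fs !ft !dl actr_ih /=; zmodule.
- move=> v; apply: inj_h.
  transitivity (mor_phi f (ext_ih E (c_V c v)) - ext_ih E' (c_V c' v)).
    by rewrite fi -linearB.
  rewrite !dl (pr_V E_c) (pr_V E_c') -R_iW !dl mor_R ?fs ?ft !dl /=; zmodule.
Qed.

(** The isomorphism sends [s x + ext_ih E y] to [s' x + ext_ih E' (phi x + y)], and acts on the
    other space through [psi] in the same way. The coboundary equations make it a morphism. *)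
Lemma coboundary_ext_iso (E E' : ext) s t c s' t' c' :
  @presents E s t c -> @presents E' s' t' c' ->
  coboundary (c - c') -> ext_iso E E'.
Proof.
move=> E_c E_c' /coboundary2P[phi [psi [Egg EgV EVg EV]]].
have dl := (@linearBl, @linearDl, @linearBr, @linearDr, @linearB, @linearD).
have [r [rV [rE rVE]]] := presents_retraction E_c.
have inj_h := short_exact_inj (exact_g E).
have inj_W := short_exact_inj (exact_V E).
pose f : {linear rrb_g (ext_tot E) -> rrb_g (ext_tot E')} :=
  (s' \o pg E) \+ (ext_ih E' \o ((phi \o pg E) \+ r)).
pose fV : {linear rrb_V (ext_tot E) -> rrb_V (ext_tot E')} :=
  (t' \o pV E) \+ (ext_iW E' \o ((psi \o pV E) \+ rV)).
have fE y : f y = s' (pg E y) + ext_ih E' (phi (pg E y) + r y) by [].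
have fVE y : fV y = t' (pV E y) + ext_iW E' (psi (pV E y) + rV y) by [].
(* The kernel coordinates of the operations of [E] are computed first; both sides are compared in
   [E] after adding the section part. *)
have r_brk y z : r (brk y z) =
    c_gg c (pg E y) (pg E z) + actl (pg E y) (r z) + actr (r y) (pg E z).
  apply: inj_h; apply: (addrI (s (pg E (brk y z)))); rewrite -rE.
  rewrite {1}(rE y) {1}(rE z) !dl brk_ih (pr_gg E_c) (pr_hl E_c) (pr_hr E_c).
  by rewrite mor_br; zmodule.
have r_actl y w : rV (actl y w) =
    c_gV c (pg E y) (pV E w) + actl (pg E y) (rV w) + rr_r M (r y) (pV E w).
  apply: inj_W; apply: (addrI (t (pV E (actl y w)))); rewrite -rVE.
  rewrite {1}(rE y) {1}(rVE w) !dl actl_ih (pr_gV E_c) (pr_Wl E_c) (pr_r E_c).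
  by rewrite mor_l; zmodule.
have r_actr w y : rV (actr w y) =
    c_Vg c (pV E w) (pg E y) + actr (rV w) (pg E y) + rr_l M (pV E w) (r y).
  apply: inj_W; apply: (addrI (t (pV E (actr w y)))); rewrite -rVE.
  rewrite {1}(rE y) {1}(rVE w) !dl actr_ih (pr_Vg E_c) (pr_Wr E_c) (pr_l E_c).
  by rewrite mor_r; zmodule.
have r_R w : r (rrb_R (ext_tot E) w) = c_V c (pV E w) + S (rV w).
  apply: inj_h; apply: (addrI (s (pg E (rrb_R (ext_tot E) w)))); rewrite -rE.
  rewrite {1}(rVE w) !dl R_iW (pr_V E_c).
  by rewrite mor_R; zmodule.
have f_brk y z : f (brk y z) = brk (f y) (f z).
  rewrite !fE r_brk mor_br.
  (* Splitting [c] into [c'] and [c - c'] lets the coboundary equation enter. *)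
  have -> : c_gg c (pg E y) (pg E z) = c_gg c' (pg E y) (pg E z) +
      c_gg (c - c') (pg E y) (pg E z) by rewrite addrC subrK.
  rewrite Egg !dl (pr_gg E_c') !(pr_hl E_c', pr_hr E_c') !brk_ih.
  zmodule.
have f_actl y w : fV (actl y w) = actl (f y) (fV w).
  rewrite fE !fVE r_actl mor_l.
  have -> : c_gV c (pg E y) (pV E w) = c_gV c' (pg E y) (pV E w) +
      c_gV (c - c') (pg E y) (pV E w) by rewrite addrC subrK.
  rewrite EgV !dl (pr_gV E_c') !(pr_Wl E_c', pr_r E_c') !actl_ih.
  zmodule.
have f_actr w y : fV (actr w y) = actr (fV w) (f y).
  rewrite fE !fVE r_actr mor_r.
  have -> : c_Vg c (pV E w) (pg E y) = c_Vg c' (pV E w) (pg E y) +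
      c_Vg (c - c') (pV E w) (pg E y) by rewrite addrC subrK.
  rewrite EVg !dl (pr_Vg E_c') !(pr_Wr E_c', pr_l E_c') !actr_ih.
  zmodule.
have f_R w : f (rrb_R (ext_tot E) w) = rrb_R (ext_tot E') (fV w).
  rewrite fE fVE r_R mor_R.
  have -> : c_V c (pV E w) = c_V c' (pV E w) + c_V (c - c') (pV E w).
    by rewrite addrC subrK.
  rewrite EV !dl (pr_V E_c') !R_iW.
  zmodule.
have f_ih x : f (ext_ih E x) = ext_ih E' x.
  have rK : r (ext_ih E x) = x.
    apply: inj_h; have := rE (ext_ih E x).
    by rewrite (short_exact0 (exact_g E)) linear0 add0r.
  by rewrite fE rK (short_exact0 (exact_g E)) !linear0 !add0r.
have fV_iW x : fV (ext_iW E x) = ext_iW E' x.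
  have rK : rV (ext_iW E x) = x.
    apply: inj_W; have := rVE (ext_iW E x).
    by rewrite (short_exact0 (exact_V E)) linear0 add0r.
  by rewrite fVE rK (short_exact0 (exact_V E)) !linear0 !add0r.
have p_f y : pg E' (f y) = pg E y.
  by rewrite fE linearD /= (pr_s E_c') (short_exact0 (exact_g E')) addr0.
have pV_f y : pV E' (fV y) = pV E y.
  by rewrite fVE linearD /= (pr_t E_c') (short_exact0 (exact_V E')) addr0.
exists (RRBMor f_brk f_actl f_actr f_R); split=> //=.
(* Bijectivity follows from compatibility with the exact sequences. *)
- exact: short_exact_bijective (exact_g E) (exact_g E') f_ih p_f.
- exact: short_exact_bijective (exact_V E) (exact_V E') fV_iW pV_f.
Qed.

End Presentations.

(** * The extension of a cocycle *)

Lemma short_exact_prod (k : fieldType) (X Z : lmodType k) :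
  short_exact (fun x : X => (0 : Z, x)) fst.
Proof.
split=> [x y []//||]; apply/seteqP; split=> //.
- by move=> _ [x _ <-].
- by move=> [z x] /= ->; exists x.
- by move=> z _; exists (z, 0).
Qed.

Section TotalExtension.
Variables (k : fieldType) (A : rRB k) (M : rRB_rep A).
Local Notation g := (rrb_g A).
Local Notation V := (rrb_V A).
Local Notation R := (rrb_R A).
Local Notation h := (rr_h M).
Local Notation W := (rr_W M).
Local Notation S := (rr_S M).
Variables (al : {bilinear g -> g -> h}) (bl : {bilinear g -> V -> W}).
Variables (br : {bilinear V -> g -> W}) (ga : {linear V -> h}).

(** This and the next three operations form the semidirect product of [A] with its representation,
    twisted by the cochain. *)
Definition tot_brk (x y : g * h) : g * h :=
  (brk x.1 y.1, actl x.1 y.2 + actr x.2 y.1 + al x.1 y.1).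
Definition tot_actl (x : g * h) (v : V * W) : V * W :=
  (actl x.1 v.1, actl x.1 v.2 + rr_r M x.2 v.1 + bl x.1 v.1).
Definition tot_actr (v : V * W) (x : g * h) : V * W :=
  (actr v.1 x.1, actr v.2 x.1 + rr_l M v.1 x.2 + br v.1 x.1).
Definition tot_R (v : V * W) : g * h := (R v.1, S v.2 + ga v.1).

Let lin := (@linearPl, @linearPr, @linearP, @scalerDr).

Fact tot_brk_bilinear : bilinear_for *:%R *:%R tot_brk.
Proof.
by split=> z a x y; congr (_, _); rewrite /= !lin //; zmodule.
Qed.

Fact tot_actl_bilinear : bilinear_for *:%R *:%R tot_actl.
Proof.
by split=> z a x y; congr (_, _); rewrite /= !lin //; zmodule.
Qed.

Fact tot_actr_bilinear : bilinear_for *:%R *:%R tot_actr.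
Proof.
by split=> z a x y; congr (_, _); rewrite /= !lin //; zmodule.
Qed.

Fact tot_R_linear : linear tot_R.
Proof.
by move=> a x y; congr (_, _); rewrite /= !lin //; zmodule.
Qed.

HB.instance Definition _ := bilinear_isBilinear.Build k _ _ _ *:%R *:%R tot_brk
  tot_brk_bilinear.
HB.instance Definition _ := bilinear_isBilinear.Build k _ _ _ *:%R *:%R tot_actl
  tot_actl_bilinear.
HB.instance Definition _ := bilinear_isBilinear.Build k _ _ _ *:%R *:%R tot_actr
  tot_actr_bilinear.
HB.instance Definition _ := GRing.isLinear.Build k _ _ _ tot_R tot_R_linear.

Hypothesis eqs : cocycle_eqs (cochain2 al bl br ga).

Let dl := (@linearBl, @linearDl, @linearBr, @linearDr, @linearB, @linearD).

(** The first component is the identity in [A]. In the second, the terms in the cochain form a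
    cocycle equation and the others cancel by the laws of the representation. The remaining
    identities follow this scheme. *)
Fact tot_brkP x y z :
  tot_brk x (tot_brk y z) = tot_brk (tot_brk x y) z + tot_brk y (tot_brk x z).
Proof.
have [E _ _ _ _] := eqs.
congr (_, _) => /=; first exact: brkP.
(* The cocycle equation enters as a zero subtracted from the left-hand side. *)
rewrite !dl -[LHS]subr0 -(E x.1 y.1 z.1) /c_gg /= /vec2 /=.
rewrite (actllP x.1 y.1 z.2) (actlrP x.1 y.2 z.1) (actrrP x.2 y.1 z.1).
zmodule.
Qed.

Fact tot_actllP x y v : tot_actl x (tot_actl y v) =
  tot_actl (tot_brk x y) v + tot_actl y (tot_actl x v).
Proof.
have [_ _ _ E _] := eqs.
congr (_, _) => /=; first exact: actllP.
rewrite !dl -[LHS]subr0 -(E x.1 y.1 v.1) /c_gg /c_gV /= /vec2 /vec1 /=.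
rewrite (actllP x.1 y.1 v.2) (rr_rlP x.1 y.2 v.1) (rr_rrlP x.2 y.1 v.1).
zmodule.
Qed.

Fact tot_actlrP x v y : tot_actl x (tot_actr v y) =
  tot_actr (tot_actl x v) y + tot_actr v (tot_brk x y).
Proof.
have [_ _ E _ _] := eqs.
congr (_, _) => /=; first exact: actlrP.
rewrite !dl -[LHS]subr0 -(E x.1 v.1 y.1) /c_gg /c_gV /c_Vg /= /vec2 /vec1 /=.
rewrite (actlrP x.1 v.2 y.1) (rr_llP x.1 v.1 y.2) (rr_rrrP x.2 v.1 y.1).
zmodule.
Qed.

Fact tot_actrrP v x y : tot_actr v (tot_brk x y) =
  tot_actr (tot_actr v x) y + tot_actl x (tot_actr v y).
Proof.
have [_ E _ _ _] := eqs.
congr (_, _) => /=; first exact: actrrP.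
rewrite !dl -[LHS]subr0 -(E v.1 x.1 y.1) /c_gg /c_gV /c_Vg /= /vec2 /vec1 /=.
rewrite (actrrP v.2 x.1 y.1) (rr_lrP v.1 x.1 y.2) (rr_lrrP v.1 x.2 y.1).
zmodule.
Qed.

Fact tot_RP v w : tot_brk (tot_R v) (tot_R w) =
  tot_R (tot_actl (tot_R v) w + tot_actr v (tot_R w)).
Proof.
have [_ _ _ _ E] := eqs.
congr (_, _) => /=; first exact: rrb_RP.
rewrite !dl -[LHS]subr0 -(E v.1 w.1) /lR /rR /brR /c_gg /c_gV /c_Vg /c_V /=.
rewrite /vec2 /vec1 /=.
(* The terms mixing [V] and [W] cancel by the two compatibility laws of [S]. *)
rewrite (rr_lSP v.1 w.2) (rr_rSP v.2 w.1) !dl /=.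
zmodule.
Qed.

Definition tot_leibniz : leibniz k := @Leibniz k (g * h)%type tot_brk tot_brkP.
Definition tot_rep : leib_rep tot_leibniz :=
  @LeibRep k tot_leibniz (V * W)%type tot_actl tot_actr
    tot_actllP tot_actlrP tot_actrrP.
Definition tot_rRB : rRB k := @RRB k tot_leibniz tot_rep tot_R tot_RP.

Definition tot_ih (y : h) : g * h := (0, y).
Definition tot_iW (w : W) : V * W := (0, w).

Fact tot_ih_linear : linear tot_ih.
Proof. by move=> a x y; congr (_, _); rewrite /= scaler0 addr0. Qed.

Fact tot_iW_linear : linear tot_iW.
Proof. by move=> a x y; congr (_, _); rewrite /= scaler0 addr0. Qed.

Definition tot_s (x : g) : g * h := (x, 0).
Definition tot_t (v : V) : V * W := (v, 0).

Fact tot_s_linear : linear tot_s.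
Proof. by move=> a x y; congr (_, _); rewrite /= scaler0 addr0. Qed.

Fact tot_t_linear : linear tot_t.
Proof. by move=> a x y; congr (_, _); rewrite /= scaler0 addr0. Qed.

HB.instance Definition _ := GRing.isLinear.Build k _ _ _ tot_ih tot_ih_linear.
HB.instance Definition _ := GRing.isLinear.Build k _ _ _ tot_iW tot_iW_linear.
HB.instance Definition _ := GRing.isLinear.Build k _ _ _ tot_s tot_s_linear.
HB.instance Definition _ := GRing.isLinear.Build k _ _ _ tot_t tot_t_linear.

Let simp0 := (@linear0l, @linear0r, @linear0, @addr0, @add0r).

Definition tot_i : rRB_mor (complex_rRB S) tot_rRB.
Proof.
apply: (@RRBMor k (complex_rRB S) tot_rRB tot_ih tot_iW) => * /=.
- by congr (_, _); rewrite /= !simp0.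
- by congr (_, _); rewrite /= !simp0.
- by congr (_, _); rewrite /= !simp0.
- by congr (_, _); rewrite /= !simp0.
Defined.

Definition tot_p : rRB_mor tot_rRB A.
Proof.
pose p : {linear (g * h)%type -> g} := fst.
pose pV : {linear (V * W)%type -> V} := fst.
by apply: (@RRBMor k tot_rRB A p pV).
Defined.

Fact tot_exact_g : short_exact (mor_phi tot_i) (mor_phi tot_p).
Proof. exact: short_exact_prod. Qed.

Fact tot_exact_V : short_exact (mor_psi tot_i) (mor_psi tot_p).
Proof. exact: short_exact_prod. Qed.

Definition tot_ext : ab_ext A S := AbExt tot_exact_g tot_exact_V.

(** With the coordinate inclusions as sections, the defects are the cochain used in the
    construction. *)
Lemma tot_presents : @presents _ _ _ tot_ext
  (tot_s : {linear g -> (g * h)%type}) (tot_t : {linear V -> (V * W)%type})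
  (cochain2 al bl br ga).
Proof.
by split=> // *; apply: injective_projections;
  rewrite /= ?simp0 ?subrr ?subr0.
Qed.

End TotalExtension.

(** * Classes of extensions and cohomology classes *)

Section ExtensionClasses.
Variables (k : fieldType) (A : rRB k) (M : rRB_rep A).
Local Notation T := {E : ab_ext A (rr_S M) | ext_induces E}.

Lemma coboundary2N (c c' : cochain M 2) :
  coboundary (c - c') -> coboundary (c' - c).
Proof. by rewrite -(opprB c c') -sub0r; apply/coboundary2B/coboundary2_0. Qed.

Lemma coboundary2_trans (c c' c'' : cochain M 2) :
  coboundary (c - c') -> coboundary (c' - c'') -> coboundary (c - c'').
Proof.
move=> cc' /coboundary2N c''c'; have := coboundary2B cc' c''c'.
by rewrite opprB addrA subrK.
Qed.

(** Every extension in [T] is related to some cocycle and every cocycle to some extension; the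
    relation becomes one-to-one only on classes. *)
Definition classifies (E : T) (z : cochain M 2) : Prop :=
  exists s t, @presents _ _ _ (sval E) s t z.

Lemma classifies_exists (E : T) : exists z, classifies E z.
Proof.
by have [s [t [z E_z]]] := induces_presents (svalP E); exists z, s, t.
Qed.

Lemma classifies_cocycle (E : T) z : classifies E z -> cocycle z.
Proof. by case=> s [t]; apply: presents_cocycle. Qed.

Lemma cocycle_classifies (z : cochain M 2) :
  cocycle z -> exists E : T, classifies E z.
Proof.
move=> z_cocycle; have [z_cochain _] := z_cocycle.
have := iffLR (cocycle2P z_cochain) z_cocycle.
move: z_cocycle; have [al [bl [br [ga ->]]]] := is_cochain2_bilinear z_cochain.
move=> _ eqs; have E_z := tot_presents eqs.
by exists (exist _ _ (presents_induces E_z)); do 2!eexists; apply: E_z.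
Qed.

Lemma classifies_iso (E E' : T) z z' : classifies E z -> classifies E' z' ->
  ext_iso (sval E) (sval E') <-> coboundary (z - z').
Proof.
move=> [s [t E_z]] [s' [t' E_z']]; split.
  exact: ext_iso_coboundary E_z E_z'.
exact: coboundary_ext_iso E_z E_z'.
Qed.

(** Two cocycles of one extension are compared through an isomorphism of [E] with itself, which in
    turn comes from [z - z = 0]. *)
Lemma classifies_coboundary (E : T) z z' :
  classifies E z -> classifies E z' -> coboundary (z - z').
Proof.
move=> E_z E_z'; apply/(classifies_iso E_z E_z')/(classifies_iso E_z E_z).
by rewrite subrr; apply: coboundary2_0.
Qed.

Lemma sig_inj (X : Type) (P : X -> Prop) (u v : sig P) :
  sval u = sval v -> u = v.
Proof. by case: u v => [x Px] [y Py] /= xy; subst y; congr exist. Qed.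

(** The coset is described without a chosen representative, as everything cohomologous to a cocycle
    of a member of the class. Any cocycle of [E0] then represents it. *)
Fact ext_coset_subproof (X : Ext M) : exists z : cochain M 2, cocycle z /\
  ([set c | exists E z, [/\ sval X E, classifies E z & coboundary (c - z)]] =
   [set c | coboundary (c - z)])%classic.
Proof.
case: X => X /= [E0 ->]; have [z0 E_z0] := classifies_exists E0.
exists z0; split; first exact: classifies_cocycle E_z0.
apply/seteqP; split=> c.
  case=> E [z [E0_E E_z cz]].
  have /coboundary2N := iffLR (classifies_iso E_z0 E_z) E0_E.
  exact: coboundary2_trans.
move=> cz0; exists E0, z0; split=> //.
by apply/(classifies_iso E_z0 E_z0); rewrite subrr; apply: coboundary2_0.
Qed.

Definition ext_coset (X : Ext M) : cohomology M 2 :=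
  exist _ _ (ext_coset_subproof X).

(** Conversely, a coset collects the extensions that have a cocycle in it, and an extension built
    from a representative cocycle generates this class. *)
Fact coset_ext_subproof (Y : cohomology M 2) : exists E : T,
  (fun E' => exists z, classifies E' z /\ sval Y z) =
  (fun E' => ext_iso (sval E) (sval E')).
Proof.
case: Y => Y /= [z0 [z0_cocycle ->]].
have [E0 E_z0] := cocycle_classifies z0_cocycle; exists E0.
apply: funext => E; apply: propext; split.
  case=> z [E_z zz0]; apply/(classifies_iso E_z0 E_z).
  exact: coboundary2N.
have [z E_z] := classifies_exists E.
move=> /(iffLR (classifies_iso E_z0 E_z))/coboundary2N zz0.
by exists z.
Qed.

Definition coset_ext (Y : cohomology M 2) : Ext M :=
  exist _ _ (coset_ext_subproof Y).

Lemma ext_cosetK : cancel ext_coset coset_ext.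
Proof.
move=> X; apply: sig_inj; apply: funext => E; apply: propext.
split=> [[z [E_z [E' [z' [XE' E'_z' zz']]]]]|XE].
  have E'E : ext_iso (sval E') (sval E).
    by apply/(classifies_iso E'_z' E_z)/coboundary2N.
  (* Transitivity of isomorphism is obtained through the cocycles. *)
  case: X XE' => X /= [E0 ->] E0E'; have [z0 E_z0] := classifies_exists E0.
  apply/(classifies_iso E_z0 E_z).
  apply: coboundary2_trans (iffLR (classifies_iso E_z0 E'_z') E0E') _.
  exact: coboundary2N.
have [z E_z] := classifies_exists E; exists z; split=> //.
by exists E, z; split=> //; rewrite subrr; apply: coboundary2_0.
Qed.

(** A cochain of the resulting coset is linked to [z0] through two cocycles of one extension, which
    are cohomologous. *)
Lemma coset_extK : cancel coset_ext ext_coset.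
Proof.
move=> Y; apply: sig_inj; apply/seteqP; case: Y => Y /= [z0 [z0_cocycle ->]].
split=> c.
  case=> E [z [[z1 [E_z1 z1z0]] E_z cz]].
  apply: coboundary2_trans cz _.
  exact: coboundary2_trans (classifies_coboundary E_z E_z1) z1z0.
have [E0 E_z0] := cocycle_classifies z0_cocycle.
move=> cz0; exists E0, z0; split=> //; exists z0; split=> //.
by rewrite /= subrr; apply: coboundary2_0.
Qed.

End ExtensionClasses.

Theorem theorem6p8 (k : fieldType)
  (char0 : ([pchar k] =i pred0)%R) (A : rRB k) (M : rRB_rep A) :
  exists f : Ext M -> cohomology M 2, bijective f.
Proof.
exists (@ext_coset k A M); exists (@coset_ext k A M).
- exact: ext_cosetK.
- exact: coset_extK.
Qed.
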